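(* Let $\gamma>\rho>1$ and $\theta=\frac{1-\gamma}{1-\rho}>1$. Consider a Markov decision process $(S,A,\mathbb K,q,u,\beta)$ with $r=(1-\beta)u^{1-\rho}$ as described in the context. Let $\omega:S\to[1,\infty)$ be continuous and let $M>0$, $c\ge 1$ be constants such that: (i) for each $s\in S$ the set $A(s)$ is compact, and the correspondence $s\mapsto A(s)$ is continuous; (ii) $r(s,a)\le M\omega(s)$ for all $(s,a)\in\mathbb K$, and $r$ is positive and continuous on $\mathbb K$; (iii) the function $(s,a)\mapsto\int_S\omega(s')^\theta q(ds'|s,a)$ is continuous on $\mathbb K$, $\int_S\omega(s')^\theta q(ds'|s,a)\le c\,\omega(s)^\theta$ for all $(s,a)\in\mathbb K$, and $c^{1/\theta}\beta<1$. For $V\in\mathcal C_+^\omega$ define $$F_3V(s)=\min_{a\in A(s)}\left[r(s,a)+\beta\left(\int_S V(s')^\theta q(ds'|s,a)\right)^{1/\theta}\right],\quad s\in S.$$ Then: (a) $F_3$ maps $\mathcal C_+^\omega$ into $\mathcal C_+^\omega$ and is a $c^{1/\theta}\beta$-contraction with respect to $\|\cdot\|_\omega$. It has a unique fixed point $w_*\in\mathcal C_+^\omega$; put $v_*=w_*^{1/(1-\rho)}$. Moreover, for the $n$-th composition $F_3^n$ of $F_3$ with itself and the zero function $\hat 0$, $$\|F_3^n\hat 0-w_*\|_\omega\le\frac{c^{n/\theta}\beta^{n}}{1-c^{1/\theta}\beta}M,\qquad n\in\mathbb N.$$ (b) The Bellman equation $$v(s)=\max_{a\in A(s)}H(s,a,v),\quad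 s\in S,$$ has a unique solution in the class of functions $v:S\to(0,\infty)$ with $v^{1-\rho}\in\mathcal C_+^\omega$, namely $v_*=w_*^{1/(1-\rho)}$. (c) There exists $f_*\in\Phi$ such that $v_*(s)=H(s,f_*(s),v_* )$ for all $s\in S$. (d) The stationary policy $f_*$ is optimal.
   Context: Model. $S$ (states) and $A$ (actions) are Borel spaces, i.e. Borel subsets of complete separable metric spaces. $\mathbb K\subset S\times A$ is a non-empty Borel set whose sections $A(s)=\{a\in A:(s,a)\in\mathbb K\}$ are non-empty for each $s\in S$. $q$ is a transition probability from $\mathbb K$ to $S$ which is Feller: $(s,a)\mapsto\int_S v(s')q(ds'|s,a)$ is continuous on $\mathbb K$ for every bounded continuous $v:S\to\mathbb R$. $u:\mathbb K\to\mathbb R$ is a non-negative upper semicontinuous per-period utility, $\beta\in[0,1)$ is the discount factor, and $r(s,a)=(1-\beta)u(s,a)^{1-\rho}$ (real-valued under the hypotheses of the claim, so $u>0$). Aggregator. $H(s,a,w)=\left[r(s,a)+\beta\left(\int_S w(s')^{1-\gamma}q(ds'|s,a)\right)^{\frac{1-\rho}{1-\gamma}}\right]^{\frac1{1-\rho}}$ for $(s,a)\in\mathbb K$ and $w>0$, whenever the integral exists. Function spaces. For $v:S\to\mathbb R$, $\|v\|_\omega=\sup_{s\in S}|v(s)|/\omega(s)$. $\mathcal C_+^\omega$ is the set of non-negative continuous functions on $S$ with finite $\|\cdot\|_\omega$; $\mathcal B_+^\omega$ is the set of non-negative Borel measurable functions on $S$ with finite $\|\cdot\|_\omega$. Contraction.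 A self-map $F$ of a metric space $(X,d)$ is a $\delta$-contraction if $d(Fx_1,Fx_2)\le\delta d(x_1,x_2)$ for all $x_1,x_2\in X$. Correspondences. A correspondence $\varphi$ from $S$ to a separable metric space $Z$ is upper (lower) semicontinuous if $\{s\in S:\varphi(s)\cap D\ne\emptyset\}$ is closed (open) for every closed (open) $D\subset Z$; it is continuous if it is both upper and lower semicontinuous. Policies. $\Phi$ is the set of Borel measurable maps $f:S\to A$ with $f(s)\in A(s)$ for all $s$; each $f\in\Phi$ is identified with the stationary policy $(f,f,\ldots)$. For $f\in\Phi$, an $f$-value function is a function $v_f:S\to(0,\infty)$ with $v_f^{1-\rho}\in\mathcal B_+^\omega$ and $v_f(s)=H(s,f(s),v_f)$ for all $s\in S$. A policy $f_*\in\Phi$ is optimal if $v_{f_*}(s)=\tilde v(s)\ge v_f(s)$ for all $f\in\Phi$ and $s\in S$ (for the $f_*$-value function $v_{f_*}$ and the $f$-value functions $v_f$), where $\tilde v$ is the solution of the Bellman equation (in the class stated in the claim). *)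

(* Defs.v *)
From HB Require Import structures.
From mathcomp Require Import all_boot all_order all_algebra.
From mathcomp Require Import all_classical all_reals all_analysis.
From mathcomp Require Import measurable_realfun.

Set Implicit Arguments.
Unset Strict Implicit.
Unset Printing Implicit Defensive.

Import Order.TTheory GRing.Theory Num.Theory.
Import numFieldNormedType.Exports.

Local Open Scope classical_set_scope.
Local Open Scope ring_scope.

(* Measurable types must be pointed in the library, hence non-empty metric
   spaces with a designated (arbitrary, never used) point. *)
#[short(type="pmetricType")]
HB.structure Definition PointedMetric (R : numDomainType) :=
  { M of Metric R M & isPointed M }.

#[short(type="completeMetricType")]
HB.structure Definition CompleteMetric (R : numDomainType) :=
  { M of Complete M & Metric R M }.

(* T with its Borel sigma-algebra; on a product T this is the sigma-algebra
   generated by the open sets of the product topology. *)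
Notation borel T := (g_sigma_algebraType (@open T)).

Definition separable (T : topologicalType) : Prop :=
  exists D : set T, countable D /\ dense D.

(* T, with its own metric, is (isometric to) a Borel subset of a complete
   separable metric space. *)
Definition borel_space (R : realType) (T : metricType R) : Prop :=
  exists (X : completeMetricType R) (e : T -> X),
    [/\ separable X,
        forall x y, mdist (e x) (e y) = mdist x y &
        measurable (range e : set (borel X))].

Definition is_min (R : realType) (E : set R) (m : R) : Prop :=
  E m /\ lbound E m.

Definition is_max (R : realType) (E : set R) (m : R) : Prop :=
  E m /\ ubound E m.

Definition usc_on (R : realType) (T : topologicalType) (D : set T)
    (f : T -> R) : Prop :=
  forall x, D x -> forall c, f x < c -> \forall y \near x, D y -> f y < c.

Section Correspondences.
Context {S Z : topologicalType}.
Implicit Type phi : S -> set Z.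

Definition usc_correspondence phi : Prop :=
  forall D, closed D -> closed [set s | phi s `&` D !=set0].

Definition lsc_correspondence phi : Prop :=
  forall D, open D -> open [set s | phi s `&` D !=set0].

Definition continuous_correspondence phi : Prop :=
  usc_correspondence phi /\ lsc_correspondence phi.

End Correspondences.

Section WeightedSpaces.
Context {R : realType} {S : pmetricType R}.
Implicit Types omega v : S -> R.

(* Extended-real valued, so that finiteness of the norm is a genuine
   condition. *)
Definition wnorm omega v : \bar R :=
  ereal_sup [set (`|v s| / omega s)%:E | s in [set: S]].

Definition Cplus omega : set (S -> R) :=
  [set v : S -> R | [/\ forall s, 0 <= v s, continuous v & (wnorm omega v < +oo)%E]].

Definition Bplus omega : set (S -> R) :=
  [set v : S -> R | [/\ forall s, 0 <= v s,
               measurable_fun [set: borel S] (v : borel S -> R) &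
               (wnorm omega v < +oo)%E]].

End WeightedSpaces.

(* Functions on K (the kernel q, the utility u, the rewards r) are total
   functions on S * A whose values off K are irrelevant; the action set at s
   is the section [xsection K s]. *)
Section DecisionProcess.
Context {R : realType} {S A : pmetricType R}.
Variables (K : set (S * A)) (q : S * A -> probability (borel S) R).

Definition transition_probability : Prop :=
  forall B : set (borel S), measurable B ->
    measurable_fun (K : set (borel (S * A)%type)) (fun sa => q sa B).

Definition feller : Prop :=
  forall v : S -> R, continuous v -> bounded_fun v ->
    {within K, continuous (fun sa => \int[q sa]_s' v s')}.

Variables (r : S * A -> R) (beta : R).

(* [\int] here is the real-valued integral, which is 0 by convention when the
   integral of the non-negative integrand is infinite. *)
Definition H (rho gamma : R) (s : S) (a : A) (w : S -> R) : R :=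
  (r (s, a) + beta * (\int[q (s, a)]_s' (w s' `^ (1 - gamma)))
                       `^ ((1 - rho) / (1 - gamma))) `^ (1 - rho)^-1.

Definition F3_arg (theta : R) (V : S -> R) (s : S) (a : A) : R :=
  r (s, a) + beta * (\int[q (s, a)]_s' (V s' `^ theta)) `^ theta^-1.

Definition F3 (theta : R) (V : S -> R) (s : S) : R :=
  inf [set F3_arg theta V s a | a in xsection K s].

Definition Phi : set (S -> A) :=
  [set f | measurable_fun [set: borel S] (f : borel S -> borel A) /\
           forall s, xsection K s (f s)].

Variables (rho gamma : R) (omega : S -> R).

Definition value_function (f : S -> A) (v : S -> R) : Prop :=
  [/\ forall s, 0 < v s,
      Bplus omega (fun s => v s `^ (1 - rho)) &
      forall s, v s = H rho gamma s (f s) v].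

Definition bellman_solution (v : S -> R) : Prop :=
  [/\ forall s, 0 < v s,
      Cplus omega (fun s => v s `^ (1 - rho)) &
      forall s, is_max [set H rho gamma s a v | a in xsection K s] (v s)].

(* vt is meant to be the solution of the Bellman equation. *)
Definition optimal (vt : S -> R) (f : S -> A) : Prop :=
  [/\ Phi f,
      value_function f vt,
      forall v, value_function f v -> v = vt &
      forall g vg, Phi g -> value_function g vg -> forall s, vg s <= vt s].

End DecisionProcess.

(* Main.v *)
(** After the substitution w = v^(1-rho) the Bellman equation reads w = F3 w.
    Minkowski's inequality in L^theta(q(.|s,a)) turns V1 <= V2 + e omega into
    F3 V1 <= F3 V2 + delta e omega with delta = c^(1/theta) beta; this single
    estimate gives monotonicity, the contraction property, and the fixed point
    as the supremum of the increasing sequence F3^n 0.  The integral of V^theta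
    is continuous in (s,a) because, by the Feller property, both V^theta and
    L omega^theta - V^theta have lower semicontinuous integrals; continuity of
    F3 V is then Berge's theorem.  The argmin correspondence is upper
    semicontinuous with compact values, and a Borel selector is obtained by
    minimizing successively the distances to the points of a dense sequence.
    Optimality follows by iterating the estimate along a fixed policy:
    sub-solutions lie below super-solutions. *)

Require Import Defs.
From HB Require Import structures.
From mathcomp Require Import all_boot all_order all_algebra.
From mathcomp Require Import all_classical all_reals all_analysis.
From mathcomp Require Import measurable_realfun.
From mathcomp Require Import ring lra.

Set Implicit Arguments.
Unset Strict Implicit.
Unset Printing Implicit Defensive.

Import Order.TTheory GRing.Theory Num.Theory.
Import numFieldNormedType.Exports.

Local Open Scope classical_set_scope.
Local Open Scope ring_scope.

(** * Berge's theorem and measurable selection *)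

Lemma cluster_closed (T : topologicalType) (F : set_system T) (C : set T) :
  closed C -> F C -> cluster F `<=` C.
Proof. by move=> cC FC x Fx; apply: cC => U Ux; apply: Fx. Qed.

(** The values [t] for which [phi t] meets the closed complement of [U] form a closed set that
    misses [s]. *)
Lemma usc_correspondence_near (S Z : topologicalType) (phi : S -> set Z) (s : S)
    (U : set Z) :
  usc_correspondence phi -> open U -> phi s `<=` U ->
  \forall t \near s, phi t `<=` U.
Proof.
move=> uphi oU sU; have /closed_openC oV := uphi _ (open_closedC oU).
have : nbhs s (~` [set t | phi t `&` ~` U !=set0]).
  by apply: open_nbhs_nbhs; split => // -[a [/sU]].
apply: filterS => t /= + a ta; apply: contra_notP => Ua.
by exists a.
Qed.

Section Berge.
Context {R : realType} {S Z : topologicalType}.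
Variables (K : set (S * Z)) (f : S * Z -> R).
Hypothesis K_compact : forall s, compact (xsection K s).
Hypothesis K_usc : usc_correspondence (xsection K).

Hypothesis f_lsc : usc_on K (fun x => - f x).

(** Lower semicontinuity of [f] is encoded as upper semicontinuity of [- f]. Compactness gives one
    neighbourhood of [s] on which the bound holds near every action of the section in [D]; upper
    semicontinuity of the correspondence then confines nearby sections to those actions or to the
    complement of [D]. *)
Lemma open_lt_on_closed (D : set Z) (c : R) : closed D ->
  open [set s | forall a, K (s, a) -> D a -> c < f (s, a)].
Proof.
move=> cD; rewrite openE => s sc; rewrite /interior.
have /compact_near_coveringP nc := compact_closedI (@K_compact s) cD.
(* [P U a] says that the bound holds on [U] times some neighbourhood of [a]; the near-covering form
   of compactness makes one small [U] serve all [a]. *)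
pose P (U : set S) (a : Z) :=
  \forall b \near a, forall t, U t -> K (t, b) -> c < f (t, b).
have : \forall U \near powerset_filter_from (nbhs s),
    (xsection K s `&` D) `<=` P U.
  apply: nc => a [/xsectionP Ka Da].
  have /(f_lsc Ka) : - f (s, a) < - c by rewrite ltrN2 sc.
  move=> [[/= U V]] [sU aV] UV.
  near=> b W => /=.
  have WU : W `<=` U by near: W; exact: small_set_sub.
  have : nbhs b V by near: b; apply/nbhs_interior.
  apply: filterS => d Vd t Wt Ktd.
  by have := UV (t, d) (conj (WU _ Wt) Vd) Ktd; rewrite ltrN2.
move=> /near_powerset_filter_fromP []; first move=> U V UV VP a aP.
  by apply: filterS (VP _ aP) => b + t Ut; apply; apply: UV.
move=> U sU UP.
pose V := interior [set b | forall t, U t -> K (t, b) -> c < f (t, b)].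
have : nbhs s [set t | xsection K t `<=` V `|` ~` D].
  apply: usc_correspondence_near => //.
    by apply: openU; [exact: open_interior|exact: closed_openC].
  move=> a sa; have [Da|] := pselect (D a); last by right.
  by left; apply: UP.
apply: filterS2 sU => t Ut tV a Ka Da.
have /xsectionP /tV [|//] := Ka.
by move=> /interior_subset; exact.
Unshelve. all: end_near. Qed.

End Berge.

(** Upper semicontinuity keeps [f] below [c] on a product neighbourhood of [(s, a)]; lower
    semicontinuity of the correspondence makes nearby sections meet its second factor. *)
Lemma open_exists_lt (R : realType) (S Z : topologicalType)
    (K : set (S * Z)) (f : S * Z -> R) (c : R) :
  lsc_correspondence (xsection K) -> usc_on K f ->
  open [set s | exists2 a, K (s, a) & f (s, a) < c].
Proof.
move=> lK uf; rewrite openE => s [a Ka fc]; rewrite /interior.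
have [[/= U V]] := uf _ Ka _ fc.
move=> [sU aV] UV.
have : nbhs s [set t | xsection K t `&` interior V !=set0].
  apply: open_nbhs_nbhs; split; first exact: lK (@open_interior _ V).
  by exists a; split; [apply/xsectionP|].
apply: filterS2 sU => t Ut [b [/xsectionP Kb /interior_subset Vb]].
by exists b => //; exact: (UV (t, b)).
Qed.

Lemma within_section_continuous (S Z T : topologicalType)
    (K : set (S * Z)) (f : S * Z -> T) (s : S) :
  {within K, continuous f} ->
  {within xsection K s, continuous (fun a => f (s, a))}.
Proof.
move=> /subspace_continuousP fK; apply/subspace_continuousP => a /xsectionP Ka.
move=> W /(fK _ Ka) [[/= U V]] [sU aV] UV.
apply: filterS aV => b Vb /xsectionP Kb.
exact: (UV (s, b) (conj (nbhs_singleton sU) Vb) Kb).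
Qed.

Section MinimumFunction.
Context {R : realType} {S Z : topologicalType}.
Variables (K : set (S * Z)) (f : S * Z -> R) (m : S -> R).
Hypothesis K_compact : forall s, compact (xsection K s).
Hypothesis K_continuous : continuous_correspondence (xsection K).
Hypothesis f_continuous : {within K, continuous f}.
Hypothesis m_min : forall s, is_min [set f (s, a) | a in xsection K s] (m s).

Let f_usc : usc_on K f.
Proof.
move=> x Kx c fc; have /subspace_continuousP /(_ _ Kx) fx := f_continuous.
exact: (@cvgr_lt _ _ (within K (nbhs x)) _ _ _ fx _ fc).
Qed.

Let f_lsc : usc_on K (fun x => - f x).
Proof.
move=> x Kx c; rewrite ltrNl => fc.
have /subspace_continuousP /(_ _ Kx) fx := f_continuous.
have : nbhs x (fun y => K y -> - c < f y).
  exact: (@cvgr_gt _ _ (within K (nbhs x)) _ _ _ fx _ fc).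
by apply: filterS => y + Ky => /(_ Ky); rewrite ltrNl.
Qed.

Let open_min_lt c : open [set s | m s < c].
Proof.
have [_ lK] := K_continuous.
rewrite (_ : [set s | _] = [set s | exists2 a, K (s, a) & f (s, a) < c]).
  exact: open_exists_lt.
apply/seteqP; split => s /=.
  by have [[a /xsectionP Ka <-] _] := m_min s; exists a.
by move=> [a Ka]; apply: le_lt_trans; apply: (m_min s).2; exists a => //; exact/xsectionP.
Qed.

(** The sets where [m] exceeds a level are open by [open_lt_on_closed] with [D] the whole space,
    those where it stays below by [open_exists_lt]. *)
Lemma minimum_continuous : continuous m.
Proof.
move=> s; apply/cvgrPdist_lt => e e0.
have open_gt c : open [set s | c < m s].
  have [uK _] := K_continuous.
  have := @open_lt_on_closed _ _ _ _ _ K_compact uK f_lsc _ c closedT.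
  congr open; apply/seteqP; split => t /= mt.
    have [[a /xsectionP Ka <-] _] := m_min t; exact: mt.
  move=> a Ka _; apply: lt_le_trans mt _; apply: (m_min t).2.
  by exists a => //; exact/xsectionP.
have lt : nbhs s [set t | m t < m s + e].
  by apply: open_nbhs_nbhs; split; [exact: open_min_lt|rewrite /= ltrDl].
have gt : nbhs s [set t | m s - e < m t].
  by apply: open_nbhs_nbhs; split; [exact: open_gt|rewrite /= gtrBl].
apply: filterS2 lt gt => t /= t1 t2.
by rewrite distrC ltr_distl t1 t2.
Qed.

Definition argmin s : set Z := [set a | K (s, a) /\ f (s, a) = m s].

Lemma argmin_nonempty s : argmin s !=set0.
Proof. by have [[a /xsectionP Ka fa] _] := m_min s; exists a. Qed.

(** A cluster point with a value above [m s] would have a neighbourhood of such points, yet that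
    neighbourhood must meet [argmin s]. *)
Lemma argmin_compact s : compact (argmin s).
Proof.
move=> F PF FB.
have [|a [/xsectionP Ka aF]] := @K_compact s _ PF.
  by apply: filterS FB => a [Ka _]; exact/xsectionP.
exists a; split => //; split => //; apply/eqP; rewrite eq_le.
rewrite (m_min s).2 ?andbT; last by exists a => //; exact/xsectionP.
rewrite leNgt; apply/negP => fa.
have := f_lsc Ka (c := - m s); rewrite ltrN2 => /(_ fa).
move=> [[/= U V]] [sU aV] UV.
have [b [[Kb fb] Vb]] := aF _ _ FB aV.
have := UV (s, b) (conj (nbhs_singleton sU) Vb) Kb.
by rewrite /= fb ltxx.
Qed.

(** [argmin s] misses [D] exactly when some [c] lies strictly above [m s] and strictly below [f] on
    the part of the section in [D]; both conditions on [s] are open. *)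
Lemma argmin_usc : usc_correspondence argmin.
Proof.
move=> D cD.
rewrite (_ : [set s | _] = ~` \bigcup_c ([set s | m s < c] `&`
    [set s | forall a, K (s, a) -> D a -> c < f (s, a)])).
  apply: open_closedC; apply: bigcup_open => c _; apply: openI => //.
  by apply: open_lt_on_closed => //; have [] := K_continuous.
apply/seteqP; split => s /=.
  move=> [a [[Ka fa] Da]] [c _ [/= mc /(_ _ Ka Da)]].
  by rewrite fa => /(lt_trans mc); rewrite ltxx.
move=> ms; apply: contrapT => sD; apply: ms.
(* If the section misses [D], any level above [m s] serves; otherwise [c] is the midpoint between
   [m s] and the minimum of [f] over the section within [D]. *)
have [K0|/set0P sD0] := eqVneq (xsection K s `&` D) set0.
  exists (m s + 1) => //; split => /=; first by rewrite ltrDl.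
  by move=> a Ka Da; have : set0 a by rewrite -K0; split => //; exact/xsectionP.
have [||a /set_mem[/xsectionP Ka Da] amin] :=
  @compact_EVT_min _ _ (fun a => f (s, a)) _ sD0.
- exact: compact_closedI.
- apply: continuous_subspaceW (@subIsetl _ _ _) _.
  exact: within_section_continuous.
have msa : m s < f (s, a).
  rewrite lt_neqAle (m_min s).2 ?andbT; last by exists a => //; exact/xsectionP.
  by apply/eqP => fa; apply: sD; exists a.
exists ((m s + f (s, a)) / 2) => //; split => /=; first by rewrite midf_lt.
move=> b Kb Db; apply: lt_le_trans (amin b _); first by rewrite midf_lt.
by apply/mem_set; split => //; exact/xsectionP.
Qed.

End MinimumFunction.

(** * Countable separating families and lexicographic selection *)

(** If the images were distinct, a point of [D] within half their distance of [e x] would be equally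
    close to [e y], against the triangle inequality. *)
Lemma isometry_separating (R : realType) (T X : metricType R) (e : T -> X)
    (D : set X) :
  (forall x y, mdist (e x) (e y) = mdist x y) -> dense D ->
  forall x y, (forall z, D z -> mdist (e x) z = mdist (e y) z) -> x = y.
Proof.
move=> ie dD x y exy; apply: mdist_positivity; rewrite -ie.
apply/eqP; rewrite eq_le mdist_ge0 andbT leNgt; apply/negP => xy0.
have [||z [/interior_subset + Dz]] :=
    dD (interior (ball (e x) (mdist (e x) (e y) / 2))).
- by exists (e x); apply: nbhsx_ballx; rewrite divr_gt0.
- exact: open_interior.
rewrite ballEmdist /= => xz.
have := metric_triangle (e x) z (e y).
by rewrite (metric_sym z) -exy // leNgt [ltRHS]splitr ltrD.
Qed.

Lemma mdist_isometry_continuous (R : realType) (T X : metricType R) (e : T -> X)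
    (z : X) :
  (forall x y, mdist (e x) (e y) = mdist x y) ->
  continuous (fun x => mdist (e x) z).
Proof.
move=> ie x; apply/cvgrPdist_lt => eps eps0.
have : nbhs x (ball x eps) by exact: nbhsx_ballx.
apply: filterS => y; rewrite ballEmdist /= -ie => xy.
have t1 := metric_triangle (e x) (e y) z.
have t2 := metric_triangle (e y) (e x) z.
rewrite (metric_sym (e y) (e x)) in t2.
by rewrite ltr_norml; lra.
Qed.

Lemma borel_space_separating (R : realType) (T : pmetricType R) :
  borel_space T ->
  exists g : nat -> T -> R, (forall n, continuous (g n)) /\
    forall x y, (forall n, g n x = g n y) -> x = y.
Proof.
move=> [X [e [[D [cD dD]] ie _]]].
move: cD => /pfcard_geP[D0|[d]].
  (* An empty [D] is not dense, because [X] contains [e point]. *)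
  have [||x [_]] := dD setT; [by exists (e point)|exact: openT|by rewrite D0].
exists (fun n x => mdist (e x) (d n)); split => [n|x y xy].
  exact: mdist_isometry_continuous.
apply: isometry_separating ie dD _ _ _ => z.
by move=> /(@surj _ _ _ _ d) [n _ <-]; exact: xy.
Qed.

Section MeasurableSelection.
Context {d : measure_display} {S : measurableType d}.
Context {R : realType} {Z : pmetricType R}.
Variables (g : nat -> Z -> R) (B : S -> set Z).
Hypothesis g_continuous : forall n, continuous (g n).
Hypothesis g_separating : forall x y, (forall n, g n x = g n y) -> x = y.
Hypothesis B_nonempty : forall s, B s !=set0.
Hypothesis B_compact : forall s, compact (B s).
Hypothesis B_measurable : forall D : set Z, closed D ->
  measurable [set s | B s `&` D !=set0].

(** All points common to these nested sets share every value [g n], so the sets shrink to a single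
    point; that point is the selected one. *)
Fixpoint lexmin (n : nat) (s : S) : set Z :=
  if n is n'.+1 then
    [set a | lexmin n' s a /\ forall b, lexmin n' s b -> g n' a <= g n' b]
  else B s.

Lemma closed_sublevel n c : closed [set a | g n a <= c].
Proof.
by apply: (@preimage_closed _ _ (g n)) (@closed_le _ c) => ? _; exact: g_continuous.
Qed.

Lemma compact_argmin (E : set Z) n : compact E -> E !=set0 ->
  exists2 a, E a & forall b, E b -> g n a <= g n b.
Proof.
move=> cE E0; have [||a /set_mem Ea amin] := @compact_EVT_min _ _ (g n) _ E0 => //.
  exact/continuous_subspaceT/g_continuous.
by exists a => // b /mem_set /amin.
Qed.

Lemma lexmin_spec n s : compact (lexmin n s) /\ lexmin n s !=set0.
Proof.
elim: n => [|n [cE E0]] /=; first by split.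
have [a Ea amin] := compact_argmin n cE E0; split; last by exists a.
rewrite (_ : [set b | _] = lexmin n s `&` [set b | g n b <= g n a]).
  by apply: compact_closedI => //; exact: closed_sublevel.
apply/seteqP; split => b /= [Eb bmin]; split => //; first exact: bmin.
by move=> b' /amin; apply: le_trans.
Qed.

Lemma lexmin_decr m n s : (m <= n)%N -> lexmin n s `<=` lexmin m s.
Proof.
move=> /subnK <-; elim: (n - m)%N => // k ih.
by rewrite addSn => a [/ih].
Qed.

(* The minimizers of g n on lexmin n s avoid D iff some rational p lies between
   the minimum of g n on lexmin n s and its minimum on lexmin n s `&` D. *)
Lemma lexmin_measurable n (D : set Z) : closed D ->
  measurable [set s | lexmin n s `&` D !=set0].
Proof.
elim: n D => [|n ih] D cD; first exact: B_measurable.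
pose L c := [set a | g n a <= c].
rewrite (_ : [set s | _] = ~` \bigcup_(p : rat)
  ([set s | lexmin n s `&` L (ratr p) !=set0] `\`
   [set s | lexmin n s `&` (D `&` L (ratr p)) !=set0])); last first.
  apply/seteqP; split => s /=.
    move=> [a [[Ea amin] Da]] [p _ [/= [b [Eb bp]] /= h]].
    by apply: h; exists a; split => //; split => //; exact: le_trans (amin _ Eb) bp.
  move=> h; have [cE E0] := lexmin_spec n s.
  have [a Ea amin] := compact_argmin n cE E0.
  apply: contrapT => ED.
  have [p [Ep Dp]] : exists p : rat, g n a <= ratr p /\
      ~ (lexmin n s `&` (D `&` L (ratr p)) !=set0).
    have [D0|/set0P D0] := eqVneq (lexmin n s `&` D) set0.
      have /rat_in_itvoo[p] : g n a < g n a + 1 by rewrite ltrDl.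
      rewrite in_itv /= => /andP[/ltW ap _]; exists p; split => //.
      by rewrite setIA D0 set0I => -[].
    have [b [Eb Db] bmin] := compact_argmin n (compact_closedI cE cD) D0.
    have : g n a < g n b.
      rewrite lt_neqAle amin // andbT; apply/eqP => ab; apply: ED.
      by exists b; split => //; split => // b' /amin; rewrite -ab.
    move=> /rat_in_itvoo[p]; rewrite in_itv /= => /andP[/ltW ap pb].
    exists p; split => // -[b' [Eb' [Db' b'p]]].
    by have := lt_le_trans pb (bmin _ (conj Eb' Db')); rewrite ltNge b'p.
  by apply: h; exists p => //; split => //; exists a.
apply: measurableC; apply: bigcupT_measurable_rat => p; apply: measurableD.
  by apply: ih; exact: closed_sublevel.
by apply: ih; apply: closedI => //; exact: closed_sublevel.
Qed.

Lemma lexmin_closed n s : closed (lexmin n s).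
Proof.
by apply: compact_closed; [exact: metric_hausdorff|have [] := lexmin_spec n s].
Qed.

(** Points chosen in [lexmin n s] within [D] cluster in the compact [B s]; each closed set
    [lexmin n s] contains a tail of the sequence, hence the cluster point. *)
Lemma lexmin_limit (D : set Z) s : closed D ->
  (forall n, lexmin n s `&` D !=set0) ->
  exists2 a, D a & forall n, lexmin n s a.
Proof.
move=> cD sD; have [a aP] := choice sD.
have [|p [Bp pa]] := @B_compact s (a @ \oo).
  by exists 0%N => // n _; have [/(lexmin_decr (leq0n n))] := aP n.
have evt n (C : set Z) : closed C -> (forall m, (n <= m)%N -> C (a m)) -> C p.
  by move=> cC Ca; apply: cluster_closed cC _ _ pa; exists n.
exists p => [|n].
  by apply: (evt 0%N) => // m _; have [] := aP m.
apply: (evt n); first exact: lexmin_closed.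
by move=> m nm; have [/(lexmin_decr nm)] := aP m.
Qed.

Lemma measurable_selection :
  exists f : S -> Z, measurable_fun [set: S] (f : S -> borel Z) /\
    forall s, B s (f s).
Proof.
have lexmin_all s : exists a, forall n, lexmin n s a.
  have [n|a _ aE] := @lexmin_limit setT s closedT.
    by rewrite setIT; have [] := lexmin_spec n s.
  by exists a.
have [f fE] := choice lexmin_all.
exists f; split => [|s]; last exact: (fE s 0%N).
apply: (@measurability _ _ S (borel Z) setT f (@open Z)) => //.
move=> _ [U oU <-]; rewrite setTI -[X in measurable X]setCK preimage_setC.
apply: measurableC.
(* The selected point avoids [U] exactly when every [lexmin n s] meets the complement of [U]:
   [lexmin_limit] then gives a common point there, and separation identifies it with [f s]. *)
rewrite (_ : _ @^-1` _ = \bigcap_n [set s | lexmin n s `&` ~` U !=set0]).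
  apply: bigcapT_measurable => n; apply: lexmin_measurable.
  exact: open_closedC.
apply/seteqP; split => s /=.
  by move=> Us n _; exists (f s).
move=> h; have [n|a aU aE] := @lexmin_limit (~` U) s (open_closedC oU).
  exact: h.
suff -> : f s = a by [].
apply: g_separating => n; apply/eqP; rewrite eq_le.
have [_ h1] := fE s n.+1; have [_ h2] := aE n.+1.
by apply/andP; split; [exact: h1 (aE n)|exact: h2 (fE s n)].
Qed.

End MeasurableSelection.

(** * Power means and Feller integrals *)

Section PowerMean.
Context d (T : measurableType d) (R : realType).
Variables (mu : {measure set T -> \bar R}) (p : R).
Hypothesis p_ge1 : 1 <= p.

(** The L^p norm of a non-negative function as a real number. An infinite integral is read as 0, so
    comparisons below carry finiteness hypotheses. *)
Definition power_mean (f : T -> R) : R := (\int[mu]_x (f x `^ p)) `^ p^-1.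

Let p_gt0 : 0 < p. Proof. exact: lt_le_trans ltr01 p_ge1. Qed.

Lemma measurable_powR_EFin (f : T -> R) : measurable_fun setT f ->
  measurable_fun setT (fun x => (f x `^ p)%:E).
Proof. by move=> mf; apply/measurable_EFinP; apply: (measurableT_comp (measurable_powR p)). Qed.

Lemma power_meanE (f : T -> R) : (forall x, 0 <= f x) ->
  power_mean f = fine ('N[mu]_(p%:E) [EFin \o f]).
Proof.
move=> f0; rewrite unlock fine_poweR; congr (_ `^ _).
by congr fine; apply: eq_integral => x _ /=; rewrite ger0_norm.
Qed.

Lemma le_integral_powR (f h : T -> R) :
  measurable_fun setT f -> measurable_fun setT h ->
  (forall x, 0 <= f x) -> (forall x, f x <= h x) ->
  (\int[mu]_x (f x `^ p)%:E <= \int[mu]_x (h x `^ p)%:E)%E.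
Proof.
move=> mf mh f0 fh; apply: ge0_le_integral => //.
- by move=> x _; rewrite lee_fin powR_ge0.
- exact: measurable_powR_EFin.
- exact: measurable_powR_EFin.
- move=> x _; rewrite lee_fin ge0_ler_powR ?nnegrE //; first exact: ltW.
  exact: le_trans (f0 x) (fh x).
Qed.

Lemma integral_powRZ (D : R) (W : T -> R) : 0 <= D ->
  measurable_fun setT W -> (forall x, 0 <= W x) ->
  (\int[mu]_x ((D * W x) `^ p)%:E = (D `^ p)%:E * \int[mu]_x (W x `^ p)%:E)%E.
Proof.
move=> D0 mW W0; rewrite -ge0_integralZl_EFin ?powR_ge0 //.
- by apply: eq_integral => x _; rewrite powRM.
- by move=> x _; rewrite lee_fin powR_ge0.
- exact: measurable_powR_EFin.
Qed.

Lemma integral_powR_lty (D : R) (f W : T -> R) : 0 <= D ->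
  measurable_fun setT f -> measurable_fun setT W ->
  (forall x, 0 <= f x) -> (forall x, 0 <= W x) -> (forall x, f x <= D * W x) ->
  (\int[mu]_x (W x `^ p)%:E < +oo)%E ->
  (\int[mu]_x (f x `^ p)%:E < +oo)%E.
Proof.
move=> D0 mf mW f0 W0 fW Wy; apply: le_lt_trans (le_integral_powR mf _ f0 fW) _.
  exact: measurable_funM.
by rewrite integral_powRZ // lte_mul_pinfty ?lee_fin ?powR_ge0.
Qed.

Lemma le_power_mean (f h : T -> R) :
  measurable_fun setT f -> measurable_fun setT h ->
  (forall x, 0 <= f x) -> (forall x, f x <= h x) ->
  (\int[mu]_x (h x `^ p)%:E < +oo)%E ->
  power_mean f <= power_mean h.
Proof.
move=> mf mh f0 fh hy; have le_fh := le_integral_powR mf mh f0 fh.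
have int_ge0 (k : T -> R) : (0 <= \int[mu]_x (k x `^ p)%:E)%E.
  by apply: integral_ge0 => x _; rewrite lee_fin powR_ge0.
apply: ge0_ler_powR; rewrite ?nnegrE ?invr_ge0 ?(ltW p_gt0) ?fine_ge0 //.
by apply: fine_le => //; rewrite ge0_fin_numE //; exact: le_lt_trans hy.
Qed.

Lemma power_meanZ (D : R) (W : T -> R) : 0 <= D ->
  measurable_fun setT W -> (forall x, 0 <= W x) ->
  power_mean (fun x => D * W x) = D * power_mean W.
Proof.
move=> D0 mW W0; rewrite /power_mean /Rintegral integral_powRZ //.
have [->|Dn0] := eqVneq D 0.
  by rewrite powR0 ?gt_eqF // mul0e /= powR0 ?mul0r // invr_eq0 gt_eqF.
have Ip : (0 <= \int[mu]_x (W x `^ p)%:E)%E.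
  by apply: integral_ge0 => x _; rewrite lee_fin powR_ge0.
have Dp : 0 < D `^ p by rewrite powR_gt0 // lt_neqAle eq_sym Dn0.
case: (\int[mu]_x (W x `^ p)%:E)%E Ip => [t||//] /=; rewrite ?lee_fin => t0.
  rewrite powRM ?powR_ge0 // -powRrM divff ?powRr1 // gt_eqF //.
(* When the integral of [W] to the power [p] is infinite, both sides equal 0 by the convention. *)
by rewrite gt0_muley ?lte_fin //= powR0 ?mulr0 // invr_eq0 gt_eqF.
Qed.

Lemma power_meanD (f g : T -> R) :
  measurable_fun setT f -> measurable_fun setT g ->
  (forall x, 0 <= f x) -> (forall x, 0 <= g x) ->
  (\int[mu]_x (f x `^ p)%:E < +oo)%E -> (\int[mu]_x (g x `^ p)%:E < +oo)%E ->
  power_mean (fun x => f x + g x) <= power_mean f + power_mean g.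
Proof.
move=> mf mg f0 g0 fy gy.
have Ny (k : T -> R) : (forall x, 0 <= k x) ->
    (\int[mu]_x (k x `^ p)%:E < +oo)%E -> ('N[mu]_(p%:E) [EFin \o k])%E \is a fin_num.
  move=> k0 ky; rewrite ge0_fin_numE ?Lnorm_ge0 // unlock poweR_lty //.
  rewrite (eq_integral (fun x => (k x `^ p)%:E)) // => x _ /=.
  by rewrite ger0_norm.
have mink := @minkowski_EFin _ _ _ mu f g p mf mg p_ge1.
rewrite !power_meanE => [|//|//|x]; last by rewrite addr_ge0.
have Nfg : ('N[mu]_(p%:E) [EFin \o f] + 'N[mu]_(p%:E) [EFin \o g])%E \is a fin_num.
  by rewrite fin_numD !Ny.
rewrite -fineD ?Ny //; apply: fine_le => //.
by rewrite ge0_fin_numE ?Lnorm_ge0 //; apply: le_lt_trans mink _; rewrite ltey_eq Nfg.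
Qed.

(** Monotonicity followed by Minkowski's inequality; the domination of [g] by [D * W] serves to make
    all the integrals finite. *)
Lemma power_mean_le_addZ (D e : R) (f g W : T -> R) :
  measurable_fun setT f -> measurable_fun setT g -> measurable_fun setT W ->
  (forall x, 0 <= f x) -> (forall x, 0 <= g x) -> (forall x, 0 <= W x) ->
  0 <= D -> (forall x, g x <= D * W x) -> (\int[mu]_x (W x `^ p)%:E < +oo)%E ->
  0 <= e -> (forall x, f x <= g x + e * W x) ->
  power_mean f <= power_mean g + e * power_mean W.
Proof.
move=> mf mg mW f0 g0 W0 D0 gD Wy e0 fg; rewrite -power_meanZ //.
have eW0 x : 0 <= e * W x by rewrite mulr_ge0.
have meW : measurable_fun setT (fun x => e * W x) by exact: measurable_funM.
apply: le_trans (le_power_mean mf _ f0 fg _) (power_meanD _ _ _ _ _ _) => //.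
- exact: measurable_funD.
- apply: (@integral_powR_lty (D + e) _ W) => //; first exact: addr_ge0.
  + exact: measurable_funD.
  + by move=> x; rewrite addr_ge0.
  + by move=> x; rewrite mulrDl lerD2r.
- exact: (@integral_powR_lty D _ W).
- exact: (@integral_powR_lty e _ W).
Qed.

End PowerMean.

Lemma continuous_borel_measurable (R : realType) (S : pmetricType R)
    (f : S -> R) :
  continuous f -> measurable_fun [set: borel S] (f : borel S -> R).
Proof.
move=> cf; apply: (@measurability _ _ (borel S) R setT f _ (@RGenOInfty.measurableE R)).
move=> _ [_ [x ->] <-]; rewrite setTI; apply: sub_sigma_algebra => /=.
rewrite (_ : f @^-1` _ = f @^-1` [set y | x < y]).
  by move/continuousP : cf; apply; exact: open_gt.
by apply/seteqP; split => s /=; rewrite in_itv /= andbT.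
Qed.

(** * Continuity of integrals of unbounded functions under the Feller property *)

Section FellerIntegral.
Context {R : realType} {S A : pmetricType R}.
Variables (K : set (S * A)) (q : S * A -> probability (borel S) R).
Hypothesis q_feller : feller K q.

(** The truncations [h n] of [g] at level [n] are bounded and continuous. By monotone convergence
    one of them already has integral above [c] at [x]; this persists nearby, and [h n] lies below
    [g]. *)
Lemma feller_lsc (g : S -> R) : continuous g -> (forall s, 0 <= g s) ->
  forall x, K x -> forall c, (c%:E < \int[q x]_s (g s)%:E)%E ->
  \forall y \near x, K y -> (c%:E < \int[q y]_s (g s)%:E)%E.
Proof.
move=> cg g0 x Kx c.
pose h (n : nat) s := Num.min (g s) n%:R.
have ch n : continuous (h n).
  move=> s; apply: (@continuous_min _ _ g (cst n%:R)); first exact: cg.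
  exact: cst_continuous.
have h0 n s : 0 <= h n s by rewrite le_min g0 ler0n.
have hg n s : h n s <= g s by rewrite ge_min lexx.
have hn n s : h n s <= n%:R by rewrite ge_min lexx orbT.
have mh n := continuous_borel_measurable (ch n).
have hE n y : (\int[q y]_s (h n s)%:E = (\int[q y]_s h n s)%:E)%E.
  rewrite fineK // ge0_fin_numE; last by apply: integral_ge0 => s _; rewrite lee_fin.
  apply: (@le_lt_trans _ _ (\int[q y]_s (cst n%:R%:E s))%E).
    apply: ge0_le_integral => //.
    - by move=> s _; rewrite lee_fin.
    - exact/measurable_EFinP.
    - by move=> s _; rewrite lee_fin.
  rewrite integral_cst //; apply: lte_mul_pinfty => //.
  exact: le_lt_trans (probability_le1 (q y) measurableT) (ltry 1).
have cvh : (\int[q x]_s (h n s)%:E @[n --> \oo] --> \int[q x]_s (g s)%:E)%E.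
  have -> : (\int[q x]_s (g s)%:E = \int[q x]_s (limn (fun n => (h n s)%:E)))%E.
    apply: eq_integral => s _; apply/esym/cvg_lim => //.
    apply: cvg_near_cst; near=> n; congr _%:E; apply: min_l.
    near: n; exact: nbhs_infty_ger.
  apply: cvg_monotone_convergence => //.
  - by move=> n; exact/measurable_EFinP.
  - by move=> n s _; rewrite lee_fin.
  - move=> s _ m n mn; rewrite lee_fin le_min hg /=.
    by apply: le_trans (hn _ _) _; rewrite ler_nat.
move=> cgx; have [n cn] : exists n, (c%:E < \int[q x]_s (h n s)%:E)%E.
  have : nbhs (\int[q x]_s (g s)%:E)%E [set y | c%:E < y]%E.
    by apply: open_nbhs_nbhs; split => //; exact: open_ereal_gt_ereal.
  by move=> /cvh [n _ /(_ n (leqnn n)) cn]; exists n.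
have bh : bounded_fun (h n).
  exists n%:R; split; first exact: num_real.
  by move=> M nM s _ /=; rewrite ger0_norm // (le_trans (hn n s)) // ltW.
have /subspace_continuousP /(_ _ Kx) := q_feller (ch n) bh.
move: cn; rewrite hE lte_fin => cn hx.
have : nbhs x (fun y => K y -> c < \int[q y]_s h n s).
  exact: (@cvgr_gt _ _ (within K (nbhs x)) _ _ _ hx _ cn).
apply: filterS => y + Ky => /(_ Ky); rewrite -lte_fin -hE => /lt_le_trans; apply.
apply: ge0_le_integral => //.
- by move=> s _; rewrite lee_fin.
- exact/measurable_EFinP.
- by apply/measurable_EFinP; exact: continuous_borel_measurable cg.
- by move=> s _; rewrite lee_fin.
Unshelve. all: end_near. Qed.

(* Both [g] and [L W - g] have lower semicontinuous integrals. *)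
Lemma feller_dominated_continuous (g W : S -> R) (L : R) :
  0 <= L -> continuous g -> continuous W ->
  (forall s, 0 <= W s) -> (forall s, 0 <= g s) -> (forall s, g s <= L * W s) ->
  {within K, continuous (fun x => \int[q x]_s (W s)%:E)%E} ->
  (forall x, K x -> (\int[q x]_s (W s)%:E < +oo)%E) ->
  {within K, continuous (fun x => \int[q x]_s g s)}.
Proof.
move=> L0 cg cW W0 g0 gW cIW IWy; apply/subspace_continuousP => x Kx.
pose h s := L * W s - g s.
have ch : continuous h.
  move=> s; apply: (@cvgB _ _ _ (nbhs s) _ (fun t => L * W t) g); last exact: cg.
  by apply: cvgM; [exact: cvg_cst|exact: cW].
have h0 s : 0 <= h s by rewrite subr_ge0.
have mW := continuous_borel_measurable cW.
have mg := continuous_borel_measurable cg.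
have mh := continuous_borel_measurable ch.
have iW y : K y -> (q y).-integrable setT (EFin \o (W : borel S -> R)).
  move=> Ky; apply/integrableP; split; first exact/measurable_EFinP.
  suff <- : (\int[q y]_s (W s)%:E = \int[q y]_s `|(W s)%:E|)%E by exact: IWy.
  by apply: eq_integral => s _; rewrite gee0_abs // lee_fin.
have iLW y : K y -> (q y).-integrable setT (EFin \o ((fun s => L * W s) : borel S -> R)).
  by move=> Ky; exact: (integrableZl measurableT L (iW y Ky)).
have dom y (k : S -> R) : K y -> measurable_fun [set: borel S] (k : borel S -> R) ->
    (forall s, 0 <= k s) -> (forall s, k s <= L * W s) ->
    (q y).-integrable setT (EFin \o (k : borel S -> R)).
  move=> Ky mk k0 kW; apply: le_integrable (iLW y Ky) => //.
    exact/measurable_EFinP.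
  by move=> s _ /=; rewrite lee_fin !ger0_norm // mulr_ge0.
have ig y : K y -> (q y).-integrable setT (EFin \o (g : borel S -> R)).
  by move=> Ky; exact: dom.
have ih y : K y -> (q y).-integrable setT (EFin \o (h : borel S -> R)).
  by move=> Ky; apply: dom => // s; rewrite gerBl.
have IgE y : K y -> \int[q y]_s h s = L * \int[q y]_s W s - \int[q y]_s g s.
  move=> Ky; rewrite (@RintegralB _ _ _ (q y) setT (fun s => L * W s) g) //;
    [by rewrite RintegralZl //; exact: iW|exact: iLW|exact: ig].
have lsc (k : S -> R) : continuous k -> (forall s, 0 <= k s) ->
    (forall y, K y -> (q y).-integrable setT (EFin \o (k : borel S -> R))) ->
    forall c, c < \int[q x]_s k s ->
    nbhs x (fun y => K y -> c < \int[q y]_s k s).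
  move=> ck k0 ik c; have kE y : K y -> (\int[q y]_s (k s)%:E = (\int[q y]_s k s)%:E)%E.
    by move=> Ky; rewrite fineK // integrable_fin_num //; exact: ik.
  rewrite -lte_fin -kE // => /(feller_lsc ck k0 Kx).
  by apply: filterS => y + Ky => /(_ Ky); rewrite kE // lte_fin.
have /subspace_continuousP /(_ _ Kx) := cIW.
move=> cWx; apply/cvgrPdist_lt => e e0.
have e2 : 0 < e / 2 by rewrite divr_gt0.
have L1 : 0 < L + 1 by rewrite ltr_wpDl.
have near_g : nbhs x (fun y => K y -> \int[q x]_s g s - e < \int[q y]_s g s).
  by apply: lsc => //; rewrite gtrBl.
have near_h : nbhs x (fun y => K y -> \int[q x]_s h s - e / 2 < \int[q y]_s h s).
  by apply: lsc => //; rewrite gtrBl.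
(* With this tolerance [L] times the variation of the integral of [W] is at most [e / 2]; dividing
   by [L + 1] also covers [L = 0]. *)
have near_W : nbhs x (fun y => K y ->
    `|\int[q x]_s W s - \int[q y]_s W s| < e / 2 / (L + 1)).
  have cvW : (fine \o (fun y => \int[q y]_s (W s)%:E)%E) @ within K (nbhs x) -->
      fine (\int[q x]_s (W s)%:E).
    apply: fine_cvg; rewrite fineK; first exact: cWx.
    by apply: integrable_fin_num => //; exact: iW.
  have := @cvgr_dist_lt _ _ _ (within K (nbhs x)) _ _ _ cvW.
  by apply; rewrite divr_gt0.
have : nbhs x (fun y => K y -> `|\int[q x]_s g s - \int[q y]_s g s| < e).
  apply: filterS3 near_g near_h near_W => y gy hy Wy Ky.
  move: (gy Ky) (hy Ky) (Wy Ky); rewrite !IgE // => gyK hyK WyK.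
  have : L * `|\int[q x]_s W s - \int[q y]_s W s| <= e / 2.
    apply: le_trans (_ : (L + 1) * (e / 2 / (L + 1)) <= _).
      by apply: ler_pM => //; [rewrite lerDl|exact: ltW].
    by rewrite mulrC divfK // gt_eqF.
  rewrite -{1}(ger0_norm L0) -normrM ler_norml => /andP[].
  rewrite ltr_norml; move: gyK hyK; clear.
  by move=> *; apply/andP; split; lra.
exact.
Qed.

End FellerIntegral.

(** * Contractions for the weighted norm *)

Lemma le_geometric (R : realType) (a b e delta : R) : 0 <= delta -> delta < 1 ->
  (forall n, a <= b + delta ^+ n * e) -> a <= b.
Proof.
move=> d0 d1 ab; rewrite leNgt; apply/negP => ba.
have cv : delta ^+ n * e @[n --> \oo] --> (0 * e : R).
  by apply: cvgM; [apply: cvg_expr; rewrite ger0_norm|exact: cvg_cst].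
rewrite mul0r in cv.
have ab0 : 0 < a - b by rewrite subr_gt0.
have [n _ /(_ n (leqnn n))] := cvgr_lt _ cv _ ab0.
by have := ab n; rewrite -lerBlDl leNgt => /negbTE ->.
Qed.

Section WeightedFixedPoint.
Context {R : realType} {S : pmetricType R}.
Variable omega : S -> R.
Hypothesis omega_ge1 : forall s, 1 <= omega s.
Hypothesis omega_continuous : continuous omega.

Lemma weight_gt0 s : 0 < omega s.
Proof. exact: lt_le_trans ltr01 (omega_ge1 s). Qed.

Lemma wnorm_leP (v : S -> R) (e : R) :
  (wnorm omega v <= e%:E)%E <-> forall s, `|v s| <= e * omega s.
Proof.
split => [ve s|ve].
  rewrite -ler_pdivrMr ?weight_gt0 // -lee_fin; apply: le_trans ve.
  by apply: ereal_sup_ubound; exists s.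
apply: ge_ereal_sup => _ [s _ <-].
by rewrite lee_fin ler_pdivrMr ?weight_gt0.
Qed.

Lemma wnorm_ltyP (v : S -> R) :
  (wnorm omega v < +oo)%E <->
  exists2 e, 0 <= e & wnorm omega v = e%:E /\ forall s, `|v s| <= e * omega s.
Proof.
split => [vy|[e _ [-> _]]]; last exact: ltry.
(* The supremum dominates its term at [point], which excludes the value of an empty supremum. *)
have v0 : (0 <= wnorm omega v)%E.
  apply: le_trans (_ : (`|v point| / omega point)%:E <= _)%E.
    by rewrite lee_fin divr_ge0 // ltW // weight_gt0.
  by apply: ereal_sup_ubound; exists point.
have vE : wnorm omega v = (fine (wnorm omega v))%:E by rewrite fineK // ge0_fin_numE.
exists (fine (wnorm omega v)); first exact: fine_ge0.
by split => //; apply/wnorm_leP; rewrite -vE.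
Qed.

Lemma wnorm_lty (v : S -> R) (e : R) : (forall s, `|v s| <= e * omega s) ->
  (wnorm omega v < +oo)%E.
Proof. by move=> /wnorm_leP /le_lt_trans; apply; exact: ltry. Qed.

Lemma Cplus_le (v : S -> R) : Cplus omega v ->
  exists2 e, 0 <= e & forall s, v s <= e * omega s.
Proof.
move=> [v0 _ /wnorm_ltyP[e e0 [_ ve]]]; exists e => // s.
by apply: le_trans (ve s); exact: ler_norm.
Qed.

Lemma Cplus0 : Cplus omega (cst 0).
Proof.
split => //; first exact: cst_continuous.
by apply: (@wnorm_lty _ 0) => s; rewrite normr0 mul0r.
Qed.

(** Near [s] the weight stays below [omega s + 1], so the convergence is locally uniform. *)
Lemma weighted_limit_continuous (x : nat -> S -> R) (w : S -> R) (delta e : R) :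
  0 <= delta -> delta < 1 -> 0 <= e ->
  (forall n, continuous (x n)) ->
  (forall n s, x n s <= w s <= x n s + delta ^+ n * e * omega s) ->
  continuous w.
Proof.
move=> d0 d1 e0 cx xw s; apply/cvgrPdist_lt => eps eps0.
have eps2 : 0 < eps / 2 by rewrite divr_gt0.
have cv : delta ^+ n * (e * (omega s + 1)) @[n --> \oo] --> (0 * (e * (omega s + 1)) : R).
  by apply: cvgM; [apply: cvg_expr; rewrite ger0_norm|exact: cvg_cst].
rewrite mul0r in cv.
have [n _ /(_ n (leqnn n)) /= dn] := cvgr_lt _ cv _ eps2.
have /cvgrPdist_lt /(_ _ eps2) near_x := cx n s.
have : nbhs s [set t | omega t < omega s + 1].
  by apply: (cvgr_lt _ (@omega_continuous s)); rewrite ltrDl.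
apply: filterS2 near_x => t xt /= ot.
have bound u : omega u <= omega s + 1 -> x n u <= w u < x n u + eps / 2.
  move=> ou; have /andP[-> wu] := xw n u; apply: le_lt_trans wu _.
  rewrite ltrD2l; apply: le_lt_trans dn; rewrite -mulrA.
  by rewrite ler_wpM2l ?exprn_ge0 // ler_wpM2l.
have /bound/andP[s1 s2] : omega s <= omega s + 1 by rewrite lerDl.
have /bound/andP[t1 t2] := ltW ot.
move: xt; rewrite !ltr_norml; move: s1 s2 t1 t2; clear => s1 s2 t1 t2 /andP[x1 x2].
by apply/andP; split; lra.
Qed.

(** * Fixed point of a monotone contraction as a supremum of iterates *)

Section FixedPoint.
Variables (F : (S -> R) -> S -> R) (delta M : R).
Hypotheses (delta_ge0 : 0 <= delta) (delta_lt1 : delta < 1) (M_ge0 : 0 <= M).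
Hypothesis F_Cplus : forall V, Cplus omega V -> Cplus omega (F V).
Hypothesis F_lip : forall V1 V2 e, Cplus omega V1 -> Cplus omega V2 -> 0 <= e ->
  (forall s, V1 s <= V2 s + e * omega s) ->
  forall s, F V1 s <= F V2 s + delta * e * omega s.
Hypothesis F0_le : forall s, F (cst 0) s <= M * omega s.

(** [F_lip] is applied in both directions with [e] the norm of the difference, which is finite
    because both functions are dominated by multiples of [omega]. *)
Lemma weighted_contraction V1 V2 : Cplus omega V1 -> Cplus omega V2 ->
  (wnorm omega (F V1 \- F V2)%R <= delta%:E * wnorm omega (V1 \- V2)%R)%E.
Proof.
move=> C1 C2; have [e1 e10 h1] := Cplus_le C1; have [e2 e20 h2] := Cplus_le C2.
have [p1 _ _] := C1; have [p2 _ _] := C2.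
have : (wnorm omega (V1 \- V2)%R < +oo)%E.
  apply: (@wnorm_lty _ (e1 + e2)) => s /=.
  have := weight_gt0 s; have := h1 s; have := h2 s; have := p1 s; have := p2 s.
  rewrite mulrDl ler_norml; set x := e1 * _; set y := e2 * _; clear.
  by move=> *; apply/andP; split; lra.
move=> /wnorm_ltyP[e e0 [-> V12]]; rewrite -EFinM; apply/wnorm_leP => s /=.
have l12 t : V1 t <= V2 t + e * omega t.
  by rewrite -lerBlDl; apply: le_trans (V12 t); exact: ler_norm.
have l21 t : V2 t <= V1 t + e * omega t.
  by rewrite -lerBlDl; apply: le_trans (V12 t); rewrite /= distrC; exact: ler_norm.
rewrite ler_norml lerBlDl F_lip // andbT.
by rewrite lerBrDl lerBlDr F_lip.
Qed.

Let x n := iter n F (cst 0).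
(** The sum of the geometric series with terms [M * delta ^+ k]; by [BE] it is stable under one
    application of [F], so it bounds all iterates. *)
Let B := M / (1 - delta).

Let xC n : Cplus omega (x n).
Proof. by elim: n => [|n ih] /=; [exact: Cplus0|exact: F_Cplus]. Qed.

(** [F_lip] with [e = 0] is monotonicity of [F]. *)
Let x_incr n s : x n s <= x n.+1 s.
Proof.
elim: n s => [|n ih] s; first by have [] := xC 1.
have := @F_lip (x n) (x n.+1) 0 (xC n) (xC n.+1) (lexx _) _ s.
by rewrite mulr0 mul0r addr0; apply => t; rewrite mul0r addr0.
Qed.

Let x_nd m n s : (m <= n)%N -> x m s <= x n s.
Proof.
by move=> /subnK <-; elim: (n - m)%N => // k /le_trans; apply; exact: x_incr.
Qed.

Let B_ge0 : 0 <= B.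
Proof. by rewrite divr_ge0 // subr_ge0 ltW. Qed.

Let BE : M + delta * B = B.
Proof.
by have d1 : 1 - delta != 0 by [rewrite subr_eq0 gt_eqF]; rewrite /B; field.
Qed.

(** For [n = 0] an inner induction bounds every iterate by [B * omega]; each further application of
    [F] to both sides contributes a factor [delta]. *)
Let x_tail n k s : x (n + k) s <= x n s + delta ^+ n * B * omega s.
Proof.
elim: n k s => [|n ih] k s.
  rewrite expr0 mul1r add0n; elim: k s => [|k ih] s.
    by rewrite lerDl mulr_ge0 // ltW // weight_gt0.
  have := F_lip (xC k) Cplus0 B_ge0 ih s => /le_trans; apply.
  by rewrite add0r -{2}BE mulrDl lerD2r.
have := F_lip (xC (n + k)) (xC n) (mulr_ge0 (exprn_ge0 n delta_ge0) B_ge0) (ih k) s.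
by rewrite exprS !mulrA.
Qed.

Let w s := sup (range (x ^~ s)).

Let x_w n s : x n s <= w s <= x n s + delta ^+ n * B * omega s.
Proof.
have ub : ubound (range (x ^~ s)) (x n s + delta ^+ n * B * omega s).
  move=> _ [m _ <-]; apply: le_trans (x_tail n m s).
  exact: x_nd (leq_addl _ _).
apply/andP; split.
  by apply: ub_le_sup; [exists (x n s + delta ^+ n * B * omega s)|exists n].
by apply: ge_sup => //; exists (x n s), n.
Qed.

Let wC : Cplus omega w.
Proof.
have w0 s : 0 <= w s by have /andP[] := x_w 0 s.
split => //.
  apply: (weighted_limit_continuous delta_ge0 delta_lt1 B_ge0 _ x_w) => n.
  by have [] := xC n.
apply: (@wnorm_lty _ B) => s; rewrite ger0_norm //.
by have /andP[_] := x_w 0 s; rewrite expr0 mul1r add0r.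
Qed.

Lemma weighted_fixed_point :
  exists w, [/\ Cplus omega w, F w = w,
    forall w', Cplus omega w' -> F w' = w' -> w' = w &
    forall n, (wnorm omega (iter n F (cst 0) \- w)%R
      <= (delta ^+ n / (1 - delta) * M)%:E)%E].
Proof.
have dB n : 0 <= delta ^+ n * B by rewrite mulr_ge0 ?exprn_ge0.
(* Applying [F] to both fixed points [n] times shrinks the initial gap [e * omega] to
   [delta ^+ n * e * omega]. *)
have le_fix (v1 v2 : S -> R) : Cplus omega v1 -> Cplus omega v2 ->
    F v1 = v1 -> F v2 = v2 -> forall s, v1 s <= v2 s.
  move=> C1 C2 f1 f2 s; have [e e0 v1e] := Cplus_le C1.
  apply: (@le_geometric _ _ _ (e * omega s) _ delta_ge0 delta_lt1) => n.
  rewrite mulrA; elim: n s => [|n ih] s.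
    have [p2 _ _] := C2; rewrite expr0 mul1r; apply: le_trans (v1e s) _.
    by rewrite lerDr.
  rewrite -{1}f1 -{1}f2 exprS -(mulrA delta).
  by apply: F_lip => //; rewrite mulr_ge0 ?exprn_ge0.
have w_x n s : w s <= x n s + delta ^+ n * B * omega s by have /andP[] := x_w n s.
(* Both inequalities compare with [x n.+1 = F (x n)] up to an error of order [delta ^+ n.+1], which
   vanishes in the limit. *)
have Fw : F w = w.
  apply/funext => s; apply/eqP; rewrite eq_le.
  have lim (a b : R) :
      (forall n, a <= b + delta * (delta ^+ n * B) * omega s) -> a <= b.
    move=> h; apply: (@le_geometric _ _ _ (delta * B * omega s) _ delta_ge0 delta_lt1).
    by move=> n; rewrite mulrA (mulrCA (delta ^+ n)).
  apply/andP; split; apply: lim => n.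
    apply: le_trans (F_lip wC (xC n) (dB n) (w_x n) s) _.
    by rewrite lerD2r; have /andP[] := x_w n.+1 s.
  apply: le_trans (w_x n.+1 s) _; rewrite exprS -(mulrA delta).
  rewrite lerD2r; have := @F_lip (x n) w 0 (xC n) wC (lexx _) _ s.
  rewrite mulr0 mul0r addr0; apply => t; rewrite mul0r addr0.
  by have /andP[] := x_w n t.
exists w; split => //.
- by move=> w' w'C Fw'; apply/funext => s; apply/eqP; rewrite eq_le !le_fix.
- move=> n; apply/wnorm_leP => s /=; rewrite distrC.
  have /andP[h1 h2] := x_w n s.
  by rewrite ger0_norm ?subr_ge0 // lerBlDl -(mulrA (delta ^+ n)) (mulrC _ M).
Qed.

End FixedPoint.
End WeightedFixedPoint.

(** * The Bellman operator *)

Section PowerFunction.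
Context {R : realType}.
Implicit Types a b l p x y : R.

Lemma powRVK p x : p != 0 -> 0 <= x -> (x `^ p^-1) `^ p = x.
Proof. by move=> p0 x0; rewrite -powRrM mulVf // powRr1. Qed.

Lemma powRKV p x : p != 0 -> 0 <= x -> (x `^ p) `^ p^-1 = x.
Proof. by move=> p0 x0; rewrite -powRrM divff // powRr1. Qed.

Lemma le0_ger_powR p x y : p <= 0 -> 0 < x -> x <= y -> y `^ p <= x `^ p.
Proof.
move=> p0 x0 xy; have y0 := lt_le_trans x0 xy.
rewrite -[p]opprK 2!(powRN _ (- p)) lef_pV2 ?posrE ?powR_gt0 //.
by rewrite ge0_ler_powR ?oppr_ge0 // nnegrE ltW.
Qed.

(** Bounds on [f t] and on its power are exchanged through the increasing inverse power [p^-1]; this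
    order argument includes the limit [l = 0]. *)
Lemma cvg_powR_nneg T (F : set_system T) {FF : Filter F} (f : T -> R) l p :
  0 < p -> (forall t, 0 <= f t) -> 0 <= l -> f @ F --> l ->
  (fun t => f t `^ p) @ F --> l `^ p.
Proof.
move=> p0 f0 l0 fl; apply/cvgrPdist_lt => e e0.
have lp0 : 0 <= l `^ p by exact: powR_ge0.
have lt_root y : 0 <= y -> (l `^ p < y) -> l < y `^ p^-1.
  move=> y0 ly; rewrite ltNge; apply/negP => yl; move: ly.
  rewrite ltNge => /negP; apply; rewrite -(@powRVK p y) ?gt_eqF //.
  by rewrite ge0_ler_powR ?nnegrE ?powR_ge0 ?(ltW p0).
have root_lt y : 0 <= y -> (y < l `^ p) -> y `^ p^-1 < l.
  move=> y0 ly; rewrite ltNge; apply/negP => yl; move: ly.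
  rewrite ltNge => /negP; apply; rewrite -(@powRVK p y) ?gt_eqF //.
  by rewrite ge0_ler_powR ?nnegrE ?powR_ge0 ?(ltW p0).
have up : \forall t \near F, f t `^ p < l `^ p + e.
  have le0 : 0 <= l `^ p + e by rewrite addr_ge0 // ltW.
  have /(cvgr_lt _ fl) : l < (l `^ p + e) `^ p^-1 by rewrite lt_root // ltrDl.
  apply: filterS => t ft; rewrite -[ltRHS](@powRVK p) ?gt_eqF //.
  by rewrite gt0_ltr_powR ?nnegrE ?powR_ge0.
have lo : \forall t \near F, l `^ p - e < f t `^ p.
  (* A negative lower bound holds trivially, and its root would be meaningless. *)
  have [y0|y0] := leP 0 (l `^ p - e); last first.
    by apply: filterE => t; apply: lt_le_trans y0 (powR_ge0 _ _).
  have /(cvgr_gt _ fl) : (l `^ p - e) `^ p^-1 < l by rewrite root_lt // gtrBl.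
  apply: filterS => t ft; rewrite -[ltLHS](@powRVK p) ?gt_eqF //.
  by rewrite gt0_ltr_powR ?nnegrE ?powR_ge0.
by apply: filterS2 up lo => t ft1 ft2; rewrite distrC ltr_distl ft2 ft1.
Qed.

End PowerFunction.

Lemma is_min_inf (R : realType) (E : set R) m : is_min E m -> inf E = m.
Proof.
move=> [Em lm]; apply/eqP; rewrite eq_le; apply/andP; split.
  by apply: ge_inf => //; exists m.
by apply: lb_le_inf => //; exists m.
Qed.

Lemma Cplus_Bplus (R : realType) (S : pmetricType R) (omega : S -> R) :
  Cplus omega `<=` Bplus omega.
Proof. by move=> v [v0 cv vy]; split => //; exact: continuous_borel_measurable. Qed.

Section BellmanOperator.
Context {R : realType} {S A : pmetricType R}.
Variables (K : set (S * A)) (q : S * A -> probability (borel S) R).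
Variables (r : S * A -> R) (omega : S -> R) (beta theta M c : R).
Hypothesis K_sections : forall s, xsection K s !=set0.
Hypothesis q_feller : feller K q.
Hypotheses (beta_ge0 : 0 <= beta) (theta_ge1 : 1 <= theta).
Hypothesis omega_ge1 : forall s, 1 <= omega s.
Hypothesis omega_continuous : continuous omega.
Hypotheses (M_ge0 : 0 <= M) (c_ge0 : 0 <= c).
Hypothesis A_compact : forall s, compact (xsection K s).
Hypothesis A_continuous : continuous_correspondence (xsection K).
Hypothesis r_bound : forall s a, K (s, a) -> r (s, a) <= M * omega s.
Hypothesis r_gt0 : forall x, K x -> 0 < r x.
Hypothesis r_continuous : {within K, continuous r}.
Hypothesis omega_int_continuous :
  {within K, continuous (fun x => \int[q x]_t (omega t `^ theta)%:E)%E}.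
Hypothesis omega_int_bound : forall s a, K (s, a) ->
  (\int[q (s, a)]_t (omega t `^ theta)%:E <= (c * omega s `^ theta)%:E)%E.
Hypothesis contractive : c `^ theta^-1 * beta < 1.

Local Notation delta := (c `^ theta^-1 * beta).
Local Notation T := (F3_arg q r beta theta).
Local Notation F := (F3 K q r beta theta).

Let theta_gt0 : 0 < theta. Proof. exact: lt_le_trans ltr01 theta_ge1. Qed.

Let omega_gt0 s : 0 < omega s. Proof. exact: weight_gt0. Qed.

Let delta_ge0 : 0 <= delta. Proof. by rewrite mulr_ge0 ?powR_ge0. Qed.

Let int_omega_lty x : K x -> (\int[q x]_t (omega t `^ theta)%:E < +oo)%E.
Proof.
by case: x => s a /omega_int_bound /le_lt_trans; apply; exact: ltry.
Qed.

Let power_mean_omega s a : K (s, a) ->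
  power_mean (q (s, a)) theta omega <= c `^ theta^-1 * omega s.
Proof.
move=> Ka; rewrite -[in leRHS](@powRKV _ theta (omega s)) ?gt_eqF ?(ltW (omega_gt0 _)) //.
rewrite -powRM ?powR_ge0 //.
apply: ge0_ler_powR; rewrite ?nnegrE ?invr_ge0 ?(ltW theta_gt0) //.
- by apply: Rintegral_ge0 => t _; exact: powR_ge0.
- by rewrite mulr_ge0 ?powR_ge0.
rewrite -lee_fin fineK; first exact: omega_int_bound.
rewrite ge0_fin_numE; first exact: int_omega_lty.
by apply: integral_ge0 => t _; rewrite lee_fin powR_ge0.
Qed.

Lemma F3_arg_gt0 V s a : K (s, a) -> 0 < T V s a.
Proof.
by move=> Ka; rewrite ltr_pwDl ?r_gt0 // mulr_ge0 ?powR_ge0.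
Qed.

(** The reward cancels and [power_mean_le_addZ] bounds the rest. The class is [Bplus] because values
    of arbitrary policies are only Borel. *)
Lemma F3_arg_lip V1 V2 e s a : Bplus omega V1 -> Bplus omega V2 -> 0 <= e ->
  (forall t, V1 t <= V2 t + e * omega t) -> K (s, a) ->
  T V1 s a <= T V2 s a + delta * e * omega s.
Proof.
move=> [V10 mV1 _] [V20 mV2 /(wnorm_ltyP omega_ge1)[D D0 [_ V2D]]] e0 V12 Ka.
rewrite -addrA lerD2l.
have V2D' t : V2 t <= D * omega t by apply: le_trans (V2D t); exact: ler_norm.
have := @power_mean_le_addZ _ (borel S) _ (q (s, a)) theta theta_ge1 D e V1 V2 omega
  mV1 mV2 (continuous_borel_measurable omega_continuous) V10 V20
  (fun t => ltW (omega_gt0 t)) D0 V2D' (int_omega_lty Ka) e0 V12.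
move=> /(ler_wpM2l beta_ge0) /le_trans; apply.
rewrite mulrDr lerD2l.
apply: le_trans (_ : beta * (e * (c `^ theta^-1 * omega s)) <= _).
  by rewrite !ler_wpM2l ?power_mean_omega.
by rewrite le_eqVlt; apply/orP; left; apply/eqP; ring.
Qed.

(** The power [V]^ theta[is dominated by a multiple of]omega [^ theta], whose integral is continuous
    by hypothesis, so [feller_dominated_continuous] applies. *)
Lemma F3_arg_continuous V : Cplus omega V ->
  {within K, continuous (fun x => T V x.1 x.2)}.
Proof.
move=> CV; have [D D0 VD] := Cplus_le omega_ge1 CV; have [V0 cV _] := CV.
have cpow (h : S -> R) : continuous h -> (forall s, 0 <= h s) ->
    continuous (fun s => h s `^ theta).
  by move=> ch h0 s; apply: cvg_powR_nneg => //; exact: ch.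
apply/subspace_continuousP => -[s a] Ka.
have /subspace_continuousP/(_ _ Ka) cr := r_continuous.
have /subspace_continuousP/(_ _ Ka) cI :
    {within K, continuous (fun x => \int[q x]_t (V t `^ theta))}.
  apply: (@feller_dominated_continuous _ _ _ K q q_feller
    (fun t => V t `^ theta) (fun t => omega t `^ theta) (D `^ theta)) => //.
  - exact: powR_ge0.
  - exact: cpow.
  - by apply: cpow => // t; exact: ltW.
  - by move=> t; exact: powR_ge0.
  - by move=> t; exact: powR_ge0.
  - move=> t; rewrite -powRM // ?(ltW (omega_gt0 _)) //.
    apply: ge0_ler_powR => //; rewrite ?nnegrE ?(ltW theta_gt0) //.
    by rewrite mulr_ge0 // ltW.
have cP : (fun x => (\int[q x]_t (V t `^ theta)) `^ theta^-1) @ within K (nbhs (s, a)) -->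
    (\int[q (s, a)]_t (V t `^ theta)) `^ theta^-1.
  apply: cvg_powR_nneg => //; rewrite ?invr_gt0 //.
  - by move=> x; apply: Rintegral_ge0 => t _; exact: powR_ge0.
  - by apply: Rintegral_ge0 => t _; exact: powR_ge0.
have cT := cvgD cr (cvgM (cvg_cst beta) cP).
rewrite [X in X @ _ --> _](_ : _ =
    fun x => r x + beta * (\int[q x]_t (V t `^ theta)) `^ theta^-1); first exact: cT.
by apply/funext => -[].
Qed.

Lemma F3_is_min V : Cplus omega V -> forall s,
  is_min [set T V s a | a in xsection K s] (F V s).
Proof.
move=> CV s; have [||a /set_mem Ka amin] := @compact_EVT_min _ _ (T V s) _ (K_sections s).
- exact: A_compact.
- exact: (within_section_continuous (F3_arg_continuous CV)).
have m : is_min [set T V s a | a in xsection K s] (T V s a).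
  by split; [exists a|move=> _ [b /mem_set Kb <-]; exact: amin].
by rewrite /F3 (is_min_inf m).
Qed.

Lemma F3_le V s a : Cplus omega V -> K (s, a) -> F V s <= T V s a.
Proof.
by move=> CV Ka; apply: (F3_is_min CV s).2; exists a => //; exact/xsectionP.
Qed.

Lemma F3_attained V s : Cplus omega V -> exists2 a, K (s, a) & T V s a = F V s.
Proof. by move=> CV; have [[a /xsectionP Ka Ta] _] := F3_is_min CV s; exists a. Qed.

(** A minimizing action for [V2] is used as a competitor for [V1]. *)
Lemma F3_lip V1 V2 e : Cplus omega V1 -> Cplus omega V2 -> 0 <= e ->
  (forall s, V1 s <= V2 s + e * omega s) ->
  forall s, F V1 s <= F V2 s + delta * e * omega s.
Proof.
move=> C1 C2 e0 V12 s; have [a Ka <-] := F3_attained s C2.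
apply: le_trans (F3_le C1 Ka) _.
by apply: F3_arg_lip => //; exact: Cplus_Bplus.
Qed.

Lemma F3_0_le s : F (cst 0) s <= M * omega s.
Proof.
have [a Ka <-] := F3_attained s (Cplus0 omega_ge1).
apply: le_trans (r_bound Ka); rewrite /F3_arg.
have -> : \int[q (s, a)]_t ((cst 0 : S -> R) t `^ theta) = 0.
  rewrite (_ : (fun t : S => _) = cst 0); first by rewrite /Rintegral integral0.
  by apply/funext => t /=; rewrite powR0 // gt_eqF.
by rewrite powR0 ?invr_eq0 ?gt_eqF // mulr0 addr0.
Qed.

Lemma F3_gt0 V s : Cplus omega V -> 0 < F V s.
Proof. by move=> CV; have [a Ka <-] := F3_attained s CV; exact: F3_arg_gt0. Qed.

Lemma F3_Cplus V : Cplus omega V -> Cplus omega (F V).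
Proof.
move=> CV; split => [s||]; first exact/ltW/F3_gt0.
  exact: (minimum_continuous A_compact A_continuous (F3_arg_continuous CV) (F3_is_min CV)).
have [D D0 VD] := Cplus_le omega_ge1 CV.
(* The constant comes from comparing [V] with the zero function: [F (cst 0)] contributes [M], the
   domination of [V] by [D * omega] contributes [delta * D]. *)
apply: (@wnorm_lty _ _ _ omega_ge1 _ (M + delta * D)) => s.
rewrite ger0_norm ?(ltW (F3_gt0 s CV)) // mulrDl.
apply: le_trans (F3_lip CV (Cplus0 omega_ge1) D0 _ s) _.
  by move=> t; rewrite add0r.
by rewrite lerD2r F3_0_le.
Qed.

(** The initial gap [D * omega] exists because [w2] is non-negative; each application of [T] along
    [g] multiplies it by [delta]. This gives both uniqueness of the value of a policy and
    optimality. *)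
Lemma policy_comparison (g : S -> A) w1 w2 : Bplus omega w1 -> Bplus omega w2 ->
  (forall s, K (s, g s)) -> (forall s, w1 s <= T w1 s (g s)) ->
  (forall s, T w2 s (g s) <= w2 s) -> forall s, w1 s <= w2 s.
Proof.
move=> B1 B2 Kg w1T Tw2 s; have [w10 _ /(wnorm_ltyP omega_ge1)[D D0 [_ w1D]]] := B1.
have [w20 _ _] := B2.
apply: (@le_geometric _ _ _ (D * omega s) _ delta_ge0 contractive) => n.
rewrite mulrA; elim: n s => [|n ih] s.
  rewrite expr0 mul1r; apply: le_trans (ler_norm _) _; apply: le_trans (w1D s) _.
  by rewrite lerDr.
apply: le_trans (w1T s) _; rewrite exprS -(mulrA delta).
apply: le_trans (F3_arg_lip B1 B2 _ ih (Kg s)) _; last by rewrite lerD2r.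
by rewrite mulr_ge0 ?exprn_ge0.
Qed.

Lemma F3_selector V : Cplus omega V -> borel_space A ->
  exists f, Phi K f /\ forall s, T V s (f s) = F V s.
Proof.
move=> CV /borel_space_separating [g [cg g_sep]].
have cT := F3_arg_continuous CV; have mF := F3_is_min CV.
have [|||f [mf fB]] := @measurable_selection _ (borel S) _ _ g
  (argmin K (fun x => T V x.1 x.2) (F V)) cg g_sep.
- by move=> s; exact: argmin_nonempty.
- by move=> s; exact: argmin_compact.
(* Upper semicontinuity of the argmin makes this set closed, hence Borel. *)
- move=> D cD; rewrite -[X in measurable X]setCK; apply: measurableC.
  apply: sub_sigma_algebra; apply: closed_openC.
  exact: (argmin_usc A_compact A_continuous cT mF).
exists f; split; last by move=> s; have [] := fB s.
by split => // s; have [/xsectionP] := fB s.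
Qed.

(** * Return from [F3] to the aggregator [H] *)

Section Aggregator.
Variables rho gamma : R.
Hypotheses (rho_gt1 : 1 < rho) (thetaE : theta = (1 - gamma) / (1 - rho)).

Let rho_neq0 : 1 - rho != 0. Proof. by rewrite subr_eq0 lt_eqF. Qed.

Let rho_lt0 : 1 - rho < 0. Proof. by rewrite subr_lt0. Qed.

(** The substitution rests on [1 - gamma = (1 - rho) * theta]. *)
Lemma H_F3_arg s a v :
  H q r beta rho gamma s a v = T (fun t => v t `^ (1 - rho)) s a `^ (1 - rho)^-1.
Proof.
have gE : 1 - gamma = (1 - rho) * theta by rewrite thetaE mulrCA divff ?mulr1.
have tE : (1 - rho) / (1 - gamma) = theta^-1 by rewrite thetaE invf_div.
have IE : \int[q (s, a)]_t (v t `^ (1 - gamma)) =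
    \int[q (s, a)]_t ((v t `^ (1 - rho)) `^ theta).
  by apply: eq_Rintegral => t _; rewrite gE powRrM.
by rewrite /H /F3_arg tE IE.
Qed.

Lemma value_functionE f v : value_function q r beta rho gamma omega f v ->
  (forall s, K (s, f s)) ->
  forall s, v s `^ (1 - rho) = T (fun t => v t `^ (1 - rho)) s (f s).
Proof.
move=> [_ _ vE] Kf s; rewrite [in LHS]vE H_F3_arg powRVK //.
exact/ltW/F3_arg_gt0.
Qed.

Variable w : S -> R.
Hypotheses (wC : Cplus omega w) (wE : F w = w).
Hypothesis w_unique : forall w', Cplus omega w' -> F w' = w' -> w' = w.

Local Notation v := (fun s => w s `^ (1 - rho)^-1).

Let w_gt0 s : 0 < w s. Proof. by rewrite -wE F3_gt0. Qed.

Let vK : (fun s => v s `^ (1 - rho)) = w.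
Proof. by apply/funext => s; rewrite powRVK // ltW. Qed.

Let rho_inv_le0 : (1 - rho)^-1 <= 0. Proof. by rewrite invr_le0 ltW. Qed.

(** The exponent [(1 - rho)^-1] is negative, so the power reverses order and minima of [T] become
    maxima of [H]. *)
Lemma fixed_point_bellman : bellman_solution K q r beta rho gamma omega v.
Proof.
split => [s||s]; first exact: powR_gt0.
  by rewrite vK.
have [[a Ka Ta] wmin] := F3_is_min wC s; rewrite wE in Ta wmin; split.
  by exists a => //; rewrite H_F3_arg vK Ta.
move=> _ [b Kb <-]; rewrite H_F3_arg vK.
by apply: le0_ger_powR => //; apply: wmin; exists b.
Qed.

Lemma bellman_unique v' :
  bellman_solution K q r beta rho gamma omega v' -> v' = v.
Proof.
move=> [v'0 v'C v'max]; pose w' s := v' s `^ (1 - rho).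
have -> : v' = fun s => w' s `^ (1 - rho)^-1.
  by apply/funext => s; rewrite powRKV // ltW.
suff -> : w' = w by [].
apply: w_unique => //; apply/funext => s; apply: is_min_inf.
have [[a Ka Ha] Hmax] := v'max s; split.
  exists a => //; rewrite /w' -Ha H_F3_arg powRVK //.
  by apply/ltW/F3_arg_gt0/xsectionP.
move=> _ [b Kb <-]; have T0 : 0 < T w' s b by apply/F3_arg_gt0/xsectionP.
rewrite -[leRHS](@powRVK _ (1 - rho)) ?(ltW T0) //.
apply: le0_ger_powR; rewrite ?(ltW rho_lt0) ?powR_gt0 //.
by rewrite -H_F3_arg; apply: Hmax; exists b.
Qed.

Lemma selector_optimal f : Phi K f ->
  (forall s, v s = H q r beta rho gamma s (f s) v) ->
  optimal K q r beta rho gamma omega v f.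
Proof.
move=> Pf vf; have vV : value_function q r beta rho gamma omega f v.
  by split => // [s|]; [exact: powR_gt0|rewrite vK; exact: Cplus_Bplus].
have Kf g : Phi K g -> forall s, K (s, g s).
  by move=> [_ Kg] s; exact/xsectionP.
have wT s : w s = T w s (f s).
  by have := value_functionE vV (Kf f Pf) s; rewrite vK powRVK // ltW.
have wB := Cplus_Bplus wC.
split => // [v1 v1V|g vg Pg vgV s].
  have [v10 v1B _] := v1V; have v1E := value_functionE v1V (Kf f Pf).
  apply/funext => s; rewrite -[LHS](@powRKV _ (1 - rho)) ?(ltW (v10 s)) //.
  (* Both [w] and the transform of [v1] solve the policy equation of [f], so each is a sub-solution
     and a super-solution. *)
  congr (_ `^ _); apply/eqP; rewrite eq_le; apply/andP; split.
    by apply: (policy_comparison v1B wB (Kf f Pf)) => t; [rewrite {1}v1E|rewrite -wT].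
  by apply: (policy_comparison wB v1B (Kf f Pf)) => t; [rewrite {1}wT|rewrite -v1E].
have [vg0 vgB _] := vgV; have vgE := value_functionE vgV (Kf g Pg).
rewrite -[leLHS](@powRKV _ (1 - rho)) ?(ltW (vg0 s)) //.
apply: le0_ger_powR => //.
(* Since [w = F w] is at most [T w] along [g], it is a sub-solution for [g], while the transform of
   [vg] is a solution; the negative power has already reversed the inequality. *)
apply: (policy_comparison wB vgB (Kf g Pg)) => t; last by rewrite -vgE.
by rewrite -{1}wE; apply: F3_le => //; exact: Kf.
Qed.

End Aggregator.
End BellmanOperator.

(** * Assembly of the four claims *)

Theorem theorem3 (R : realType) (S A : pmetricType R)
    (S_borel : borel_space S) (A_borel : borel_space A)
    (K : set (S * A)) (K_nonempty : K !=set0)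
    (K_borel : measurable (K : set (borel (S * A)%type)))
    (K_sections : forall s, xsection K s !=set0)
    (q : S * A -> probability (borel S) R)
    (q_transition : transition_probability K q) (q_feller : feller K q)
    (u : S * A -> R) (u_ge0 : forall sa, K sa -> 0 <= u sa)
    (u_usc : usc_on K u)
    (beta : R) (beta_ge0 : 0 <= beta) (beta_lt1 : beta < 1)
    (gamma rho theta : R) (rho_gt1 : 1 < rho) (rho_lt_gamma : rho < gamma)
    (thetaE : theta = (1 - gamma) / (1 - rho))
    (r : S * A -> R)
    (rE : forall sa, K sa -> r sa = (1 - beta) * u sa `^ (1 - rho))
    (omega : S -> R) (omega_ge1 : forall s, 1 <= omega s)
    (omega_continuous : continuous omega)
    (M c : R) (M_gt0 : 0 < M) (c_ge1 : 1 <= c)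
    (A_compact : forall s, compact (xsection K s))
    (A_continuous : continuous_correspondence (xsection K))
    (r_bound : forall s a, K (s, a) -> r (s, a) <= M * omega s)
    (r_gt0 : forall sa, K sa -> 0 < r sa)
    (r_continuous : {within K, continuous r})
    (omega_int_continuous :
      {within K, continuous
        (fun sa => \int[q sa]_s' (omega s' `^ theta)%:E)%E})
    (omega_int_bound : forall s a, K (s, a) ->
      (\int[q (s, a)]_s' (omega s' `^ theta)%:E
         <= (c * omega s `^ theta)%:E)%E)
    (c_beta_lt1 : c `^ theta^-1 * beta < 1) :
  let F := F3 K q r beta theta in
  let delta := c `^ theta^-1 * beta in
  [/\ forall V, Cplus omega V -> forall s,
        is_min [set F3_arg q r beta theta V s a | a in xsection K s] (F V s),
      forall V, Cplus omega V -> Cplus omega (F V) &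
      forall V1 V2, Cplus omega V1 -> Cplus omega V2 ->
        (wnorm omega (F V1 \- F V2)%R
           <= delta%:E * wnorm omega (V1 \- V2)%R)%E] /\
  exists w : S -> R,
    let v := fun s => w s `^ (1 - rho)^-1 in
    [/\ [/\ Cplus omega w, F w = w,
            forall w', Cplus omega w' -> F w' = w' -> w' = w &
            forall n, (wnorm omega (iter n F (cst 0%R) \- w)%R
              <= (c `^ (n%:R / theta) * beta ^+ n /
                  (1 - c `^ theta^-1 * beta) * M)%:E)%E],
        bellman_solution K q r beta rho gamma omega v /\
        (forall v', bellman_solution K q r beta rho gamma omega v' -> v' = v),
        exists f, Phi K f /\ (forall s, v s = H q r beta rho gamma s (f s) v) &
        forall f, Phi K f -> (forall s, v s = H q r beta rho gamma s (f s) v) ->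
          optimal K q r beta rho gamma omega v f].
Proof.
have theta_ge1 : 1 <= theta.
  rewrite thetaE -mulrNN -invrN !opprB ler_pdivlMr ?subr_gt0 // mul1r.
  by rewrite lerD2r ltW.
have theta_neq0 : theta != 0 by rewrite gt_eqF // (lt_le_trans ltr01).
have c_ge0 : 0 <= c by exact: le_trans ler01 c_ge1.
have M_ge0 := ltW M_gt0.
have delta_ge0 : 0 <= c `^ theta^-1 * beta by rewrite mulr_ge0 ?powR_ge0.
move=> F delta.
have F_min V : Cplus omega V -> forall s,
    is_min [set F3_arg q r beta theta V s a | a in xsection K s] (F V s).
  by apply: (@F3_is_min _ _ _ K q r omega beta theta c).
have F_C V : Cplus omega V -> Cplus omega (F V).
  by apply: (@F3_Cplus _ _ _ K q r omega beta theta M c).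
have F_lip V1 V2 e : Cplus omega V1 -> Cplus omega V2 -> 0 <= e ->
    (forall s, V1 s <= V2 s + e * omega s) ->
    forall s, F V1 s <= F V2 s + delta * e * omega s.
  by apply: (@F3_lip _ _ _ K q r omega beta theta c).
have F_0 s : F (cst 0) s <= M * omega s.
  by apply: (@F3_0_le _ _ _ K q r omega beta theta M c).
split; first by split => // V1 V2; apply: weighted_contraction.
have [w [wC wE w_unique w_rate]] :=
  @weighted_fixed_point _ _ _ omega_ge1 omega_continuous F delta M
    delta_ge0 c_beta_lt1 M_ge0 F_C F_lip F_0.
exists w => v; split.
(* The stated rate is the power [delta ^+ n] written out. *)
- split => // n; rewrite (_ : c `^ (n%:R / theta) * beta ^+ n = delta ^+ n) //.
  by rewrite /delta exprMn (mulrC n%:R) powRrM powR_mulrn ?powR_ge0.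
- split; first by apply: (@fixed_point_bellman _ _ _ K q r omega beta theta c).
  by move=> v'; apply: (@bellman_unique _ _ _ K q r omega beta theta).
- have [f [Pf fw]] : exists f, Phi K f /\
      forall s, F3_arg q r beta theta w s (f s) = F w s.
    by apply: (@F3_selector _ _ _ K q r omega beta theta c).
  exists f; split => // s; rewrite (H_F3_arg _ _ _ rho_gt1 thetaE).
  have w0 t : 0 < w t by rewrite -wE; apply: (@F3_gt0 _ _ _ K q r omega beta theta c).
  rewrite (_ : (fun t => v t `^ (1 - rho)) = w) ?fw ?wE //.
  by apply/funext => t; rewrite powRVK ?ltW // subr_eq0 lt_eqF.
- by move=> f; apply: (@selector_optimal _ _ _ K q r omega beta theta c).
Qed.
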